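(* For any connected graph $G$, any graph $H$, and any integer $k\ge 2$, $$\gamma_{\le k}(G\odot H)=\gamma_{\le k-1}(G).$$
   Context: All graphs are finite, undirected, without loops or multiple edges. For graphs $G$ and $H$, where $G$ has vertices $v_1,\dots,v_{n}$, the corona graph $G\odot H$ is obtained from one copy of $G$ and $n$ copies of $H$ by joining by an edge each vertex of the $i$-th copy of $H$ with the vertex $v_i$ of $G$. A set $D$ of vertices of a graph is a distance-$k$ dominating set if for every vertex $v\notin D$ there is some $u\in D$ with $d(u,v)\le k$, where $d$ is the graph distance; $\gamma_{\le k}(G)$ is the minimum cardinality of a distance-$k$ dominating set of $G$. *)

(* Defs.v *)
From mathcomp Require Import all_boot.

Set Implicit Arguments.
Unset Strict Implicit.
Unset Printing Implicit Defensive.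

Record sgraph := SGraph {
  vertex :> finType;
  adj : rel vertex;
  adj_sym : symmetric adj;
  adj_irr : irreflexive adj }.

Definition connected_graph (G : sgraph) : Prop :=
  forall u v : G, connect (@adj G) u v.

Section Distance.
Variable G : sgraph.
Implicit Types (u v : G) (D : {set G}) (k : nat).

Definition has_walk u v (n : nat) : bool :=
  [exists p : n.-tuple G, path (@adj G) u p && (last u p == v)].

Lemma connect_has_walk u v : connect (@adj G) u v -> exists n, has_walk u v n.
Proof.
case/connectP=> p Gp ->; exists (size p).
by apply/existsP; exists (in_tuple p); rewrite Gp eqxx.
Qed.

(* None stands for an infinite distance (no walk from u to v). *)
Definition dist u v : option nat :=
  match @idP (connect (@adj G) u v) with
  | ReflectT uv => Some (ex_minn (connect_has_walk uv))
  | ReflectF _ => None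
  end.

Definition dist_le u v k : bool := if dist u v is Some d then d <= k else false.

Definition dist_dominating k D : bool :=
  [forall v, (v \notin D) ==> [exists u in D, dist_le u v k]].

(* The minimum is over a nonempty family, as [set: G] is always dominating. *)
Definition dist_domination_number k : nat :=
  #|[arg min_(D < [set: G] | dist_dominating k D) #|D| ]|.

End Distance.

Section Corona.
Variables G H : sgraph.

(* inl u is the vertex u of G; inr (u, x) is the vertex x in the copy of H
   attached to u. *)
Definition corona_adj : rel (G + G * H)%type := fun a b =>
  match a, b with
  | inl u, inl v => adj u v
  | inr (u, x), inr (v, y) => (u == v) && adj x y
  | inl u, inr (v, _) | inr (v, _), inl u => u == v
  end.

Fact corona_adj_sym : symmetric corona_adj.
Proof.
by move=> [u|[u x]] [v|[v y]] //=; rewrite ?(eq_sym u v) adj_sym.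
Qed.

Fact corona_adj_irr : irreflexive corona_adj.
Proof. by move=> [u|[u x]] /=; rewrite adj_irr ?andbF. Qed.

Definition corona : sgraph := SGraph corona_adj_sym corona_adj_irr.

End Corona.

(* Main.v *)
Require Import Defs.
From mathcomp Require Import all_boot.

Set Implicit Arguments.
Unset Strict Implicit.
Unset Printing Implicit Defensive.

(** A dominating set [D] of [G] embeds in the corona, where one more step
    reaches the pendant copies of [H]. Conversely, project a dominating set of
    the corona to [G]: a vertex [v] outside the projection is seen through a
    vertex [x] of its copy of [H], and a walk that reaches [x] from outside
    that copy makes a step from [v] into the copy, which the projection to [G]
    contracts. *)

Lemma dist_leP (G : sgraph) (u v : G) (k : nat) :
  reflect (exists p, [/\ path (@adj G) u p, last u p = v & size p <= k])
          (dist_le u v k).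
Proof.
rewrite /dist_le /dist.
(* [dist] matches on the term [idP] itself, so its boolean index is generalised with it to split the
   dependent match. *)
case: {-}_ / idP => [uv|not_uv].
  case: ex_minnP => d walk_d d_min.
  apply: (iffP idP) => [dk|[q [uq qv qk]]].
    have /existsP[p /andP[up /eqP pv]] := walk_d.
    by exists p; rewrite size_tuple.
  apply: leq_trans qk; apply: d_min; apply/existsP; exists (in_tuple q).
  by rewrite uq qv eqxx.
constructor=> -[p [up pv _]]; apply: not_uv.
by apply/connectP; exists p.
Qed.

Lemma dist_domination_number_le (G : sgraph) (k : nat) (D : {set G}) :
  dist_dominating k D -> dist_domination_number G k <= #|D|.
Proof.
rewrite /dist_domination_number => domD.
case: arg_minnP => [|E _ E_min]; last exact: E_min.
by apply/forallP=> v; rewrite inE.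
Qed.

Lemma dist_domination_number_attained (G : sgraph) (k : nat) :
  exists2 D : {set G}, dist_dominating k D & dist_domination_number G k = #|D|.
Proof.
rewrite /dist_domination_number; case: arg_minnP => [|D domD _].
  by apply/forallP=> v; rewrite inE.
by exists D.
Qed.

Lemma dist_dominatingP (G : sgraph) (k : nat) (D : {set G}) :
  reflect (forall v, v \notin D -> exists2 u, u \in D & dist_le u v k)
          (dist_dominating k D).
Proof.
apply: (iffP forallP) => [domD v vD | domD v].
  by have /implyP/(_ vD)/exists_inP := domD v.
by apply/implyP=> /domD/exists_inP.
Qed.

Section CoronaWalks.
Variables G H : sgraph.

Definition corona_base (a : corona G H) : G :=
  match a with inl u => u | inr (u, _) => u end.

Lemma path_inl (u : G) (p : seq G) :
  path (@adj (corona G H)) (inl u) (map inl p) = path (@adj G) u p.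
Proof. by elim: p u => //= v p IHp u; rewrite IHp. Qed.

Lemma last_inl (u : G) (p : seq G) :
  last (inl u : corona G H) (map inl p) = inl (last u p).
Proof. exact: last_map. Qed.

Lemma dist_le_inl (u v : G) (k : nat) :
  dist_le u v k -> dist_le (inl u : corona G H) (inl v) k.
Proof.
case/dist_leP=> p [up pv pk]; apply/dist_leP; exists (map inl p).
by rewrite path_inl last_inl pv size_map.
Qed.

Lemma dist_le_inr (u v : G) (x : H) (k : nat) :
  dist_le u v k -> dist_le (inl u : corona G H) (inr (v, x)) k.+1.
Proof.
case/dist_leP=> p [up pv pk]; apply/dist_leP.
exists (rcons (map inl p) (inr (v, x))).
by rewrite rcons_path path_inl last_inl last_rcons size_rcons size_map pv up /= eqxx.
Qed.

(** Induction from the front of the walk. A walk starting inside the target copy may never enter it,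
    so it need not have a step to save; this is the first alternative. *)
Lemma corona_walk_into_copy (a : corona G H) (v : G) (x : H) p :
  path (@adj (corona G H)) a p -> last a p = inr (v, x) ->
  (exists y, a = inr (v, y)) \/
  exists q, [/\ path (@adj G) (corona_base a) q,
                last (corona_base a) q = v & size q < size p].
Proof.
elim: p a => [|c p IHp] a /=; first by move=> _ ->; left; exists x.
case/andP=> ac cp /(IHp _ cp){IHp cp}[[y c_eq]|[q [cq qv qp]]].
  subst c; case: a ac => [u|[u z]] /=.
    (* The entering step starts at [v] itself and projects to the empty walk: this is where the
       strict inequality originates. *)
    by move/eqP->; right; exists [::].
  by case/andP=> /eqP-> _; left; exists z.
(* Only an edge inside [G] lengthens [q]; the other three kinds join vertices with the same base and
   are contracted. *)
right; case: a c ac cq qv => [u|[u y]] [w|[w z]] /= ac cq qv.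
- by exists (w :: q); rewrite /= ac.
- by exists q; rewrite (eqP ac); split=> //; exact: leqW.
- by exists q; rewrite -(eqP ac); split=> //; exact: leqW.
- by case/andP: ac => /eqP-> _; exists q; split=> //; exact: leqW.
Qed.

Lemma dist_le_corona_base (a : corona G H) (v : G) (x : H) (k : nat) :
  corona_base a != v -> dist_le a (inr (v, x)) k.+1 ->
  dist_le (corona_base a) v k.
Proof.
move=> av /dist_leP[p [ap pv pk]]; apply/dist_leP.
have [[y a_eq]|[q [aq qv qp]]] := corona_walk_into_copy ap pv.
  by rewrite a_eq eqxx in av.
by exists q; split=> //; rewrite -ltnS; exact: leq_trans pk.
Qed.

Lemma dist_dominating_inl (D : {set G}) (k : nat) :
  dist_dominating k D ->
  dist_dominating k.+1 ([set inl u | u in D] : {set corona G H}).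
Proof.
move/dist_dominatingP=> domD.
(* Vertices of [D] are included, at distance 0: the copies attached to them lie outside the embedded
   set and must be reached too. *)
have near v : exists2 u, u \in D & dist_le u v k.
  have [vD|/domD//] := boolP (v \in D).
  by exists v => //; apply/dist_leP; exists [::].
apply/dist_dominatingP=> -[v|[v x]] _; have [u uD uv] := near v;
  exists (inl u); rewrite ?imset_f ?dist_le_inr //.
have /dist_leP[p [up pv pk]] := dist_le_inl uv.
by apply/dist_leP; exists p; split=> //; exact: leqW.
Qed.

Lemma dist_dominating_corona_base (D : {set corona G H}) (x : H) (k : nat) :
  dist_dominating k.+1 D -> dist_dominating k (corona_base @: D).
Proof.
move/dist_dominatingP=> domD; apply/dist_dominatingP=> v vD.
(* The vertex [x] over [v] is not in [D], since otherwise [v] would lie in the projection. For the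
   same reason its dominator [a] has a base other than [v]. *)
have [|a aD av] := domD (inr (v, x)).
  by apply: contra vD => vxD; apply/imsetP; exists (inr (v, x)).
exists (corona_base a); first exact: imset_f.
apply: dist_le_corona_base av.
by apply: contraNneq vD => <-; exact: imset_f.
Qed.

End CoronaWalks.

Theorem theorem16 (G H : sgraph) (k : nat) (G_conn : connected_graph G)
    (H_nonempty : 0 < #|H|) (k_ge2 : 2 <= k) :
  dist_domination_number (corona G H) k = dist_domination_number G (k - 1).
Proof.
case: k k_ge2 => // k _; rewrite subn1 /=.
(* This [x] gives every copy of [H] a vertex to be dominated, as the lower bound requires. *)
have [x _] := card_gt0P H_nonempty.
apply/eqP; rewrite eqn_leq; apply/andP; split.
  have [D domD ->] := dist_domination_number_attained G k.
  apply: leq_trans (leq_imset_card (inl : G -> corona G H) D).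
  exact/dist_domination_number_le/dist_dominating_inl.
have [D domD ->] := dist_domination_number_attained (corona G H) k.+1.
(* Projecting may identify vertices of [D], which can only lower the cardinality. *)
apply: leq_trans (leq_imset_card (@corona_base G H) D).
exact/dist_domination_number_le/(dist_dominating_corona_base x).
Qed.
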